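(* Let $\mathcal{G}$ be a weakly logarithmic class of assemblies with parameters $\rho,\Theta,\theta,\theta'>0$ and $n_0\ge 1$. There is a constant $C>0$, depending only on $\rho,\Theta,\theta,\theta',n_0$, such that for every $n\ge 1$ and every additive function $h:\mathcal{G}_n\to\mathbb{R}$ defined by a real array $\{h_j(k)\}$ (as in the context), $$\mathbf{V}_n h\le C\sum_{\substack{j,k\in\mathbb{N}\\ jk\le n}}\frac{\lambda_j^k\,h_j(k)^2}{k!}\,\frac{Q^{\{j\}}(n-jk)}{Q(n)}.$$
   Context: An assembly on a finite set is a partition of the set into blocks (components) together with a choice of one of finitely many structures on each block; for a block of size $j$ there are $g_j<\infty$ possible structures (the $g_j\ge 0$ are fixed integers characterizing the class $\mathcal{G}$). $\mathcal{G}_n$ is the set of assemblies on an $n$-element set. Put $\lambda_j=g_j/j!$. For $\bar s=(s_1,\dots,s_n)\in\mathbb{N}_0^n$ let $\ell(\bar s)=1s_1+2s_2+\cdots+ns_n$. Define $$Q(n)=\sum_{\ell(\bar s)=n}\prod_{i=1}^n\frac{\lambda_i^{s_i}}{s_i!},\qquad Q^{\{j\}}(n)=\sum_{\substack{\ell(\bar s)=n\\ s_j=0}}\prod_{i=1}^n\frac{\lambda_i^{s_i}}{s_i!}\ (j\in\mathbb{N}),$$ with $Q(0)=Q^{\{j\}}(0)=1$. The number of assemblies in $\mathcal{G}_n$ is $G(n)=n!\,Q(n)$. The class $\mathcal{G}$ is weakly logarithmic if there are constants $\rho,\Theta,\theta,\theta'>0$ and $n_0\ge1$ such that: (i) $\rho^j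 j\lambda_j\le\Theta$ for all $j\ge1$; (ii) $\sum_{j\le n}\rho^j j\lambda_j\ge\theta n$ for all $n\ge n_0$; (iii) $nQ(n)\rho^n\ge\theta'\exp\{\sum_{j\le n}\lambda_j\rho^j\}$ for all $n\ge1$. For $\sigma\in\mathcal{G}_n$ and $1\le j\le n$, $k_j(\sigma)\ge0$ denotes the number of components of size $j$ in $\sigma$. An additive function $h:\mathcal{G}_n\to\mathbb{R}$ is given by a real array $\{h_j(k)\}$, $j,k\in\mathbb{N}_0$, $jk\le n$, with $h_j(0)=0$ for all $j\le n$, via $h(\sigma)=\sum_{j=1}^n h_j(k_j(\sigma))$. $\mathbf{E}_n$ and $\mathbf{V}_n$ denote expectation and variance with respect to the uniform probability measure on $\mathcal{G}_n$: $\mathbf{V}_n h=\frac{1}{G(n)}\sum_{\sigma\in\mathcal{G}_n}(h(\sigma)-\mathbf{E}_n h)^2$. *)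

(* Defs.v *)
From HB Require Import structures.
From Stdlib Require Import Reals.
From mathcomp Require Import all_boot.

Set Implicit Arguments.
Unset Strict Implicit.
Unset Printing Implicit Defensive.

Notation "\rsum_ ( i <- r | P ) F" := (\big[Rplus/R0]_(i <- r | P) F)
  (at level 41, F at level 41, i, r at level 50) : R_scope.
Notation "\rsum_ ( i : T | P ) F" := (\big[Rplus/R0]_(i : T | P) F)
  (at level 41, F at level 41, i at level 50) : R_scope.
Notation "\rsum_ ( i < n | P ) F" := (\big[Rplus/R0]_(i < n | P) F)
  (at level 41, F at level 41, i, n at level 50) : R_scope.
Notation "\rsum_ ( i < n ) F" := (\big[Rplus/R0]_(i < n) F)
  (at level 41, F at level 41, i, n at level 50) : R_scope.
Notation "\rsum_ ( i : T ) F" := (\big[Rplus/R0]_(i : T) F)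
  (at level 41, F at level 41, i at level 50) : R_scope.

Local Open Scope R_scope.

(* The class G is given by the sequence g_j (number of structures on a
   block of size j). lambda_j = g_j / j!. *)
Definition lam (g : nat -> nat) (j : nat) : R := INR (g j) / INR (factorial j).

(* Component-count vectors s = (s_1,...,s_n) are represented as finite
   functions s : 'I_n -> 'I_(n+1); index i : 'I_n stands for i+1.
   (Any s with l(s) = n has s_i <= n, so this loses nothing.) *)
Definition ell (n : nat) (s : {ffun 'I_n -> 'I_n.+1}) : nat :=
  (\sum_(i < n) (i.+1 * s i))%N.

Definition Qterm (g : nat -> nat) (n : nat) (s : {ffun 'I_n -> 'I_n.+1}) : R :=
  \big[Rmult/R1]_(i < n) (pow (lam g i.+1) (s i) / INR (factorial (s i))).

(* Q(n); Q(0) = 1 since the empty vector has l = 0 and empty product 1. *)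
Definition Q (g : nat -> nat) (n : nat) : R :=
  \rsum_(s : {ffun 'I_n -> 'I_n.+1} | ell s == n) Qterm g s.

(* Q^{j}(n): only vectors with s_j = 0 (vacuous when j > n or j = 0). *)
Definition Qexcl (g : nat -> nat) (j n : nat) : R :=
  \rsum_(s : {ffun 'I_n -> 'I_n.+1}
           | (ell s == n) && [forall i : 'I_n, (i.+1 == j) ==> (s i == 0%N :> nat)])
    Qterm g s.

Definition weakly_logarithmic (g : nat -> nat)
    (rho Theta theta theta' : R) (n0 : nat) : Prop :=
  (0 < rho /\ 0 < Theta /\ 0 < theta /\ 0 < theta' /\ (1 <= n0)%nat) /\
  (forall j : nat, (1 <= j)%nat -> pow rho j * INR j * lam g j <= Theta) /\
  (forall n : nat, (n0 <= n)%nat ->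
     \rsum_(j < n.+1 | (0 < j)%nat) (pow rho j * INR j * lam g j) >= theta * INR n) /\
  (forall n : nat, (1 <= n)%nat ->
     INR n * Q g n * pow rho n >=
       theta' * exp (\rsum_(j < n.+1 | (0 < j)%nat) (lam g j * pow rho j))).

(* Assemblies on the n-set 'I_n: a set partition P of 'I_n together with a
   choice of one of g_{|B|} structures on each block B.  Since an additive
   function depends only on the block sizes, summing over assemblies equals
   summing over set partitions P weighted by the number
   prod_{B in P} g_{|B|} of structure choices on P. *)
Definition setpart (n : nat) (P : {set {set 'I_n}}) : bool :=
  partition P [set: 'I_n].

Definition nstruct (g : nat -> nat) (n : nat) (P : {set {set 'I_n}}) : R :=
  \big[Rmult/R1]_(B in P) INR (g #|B|).

Definition kcount (n : nat) (P : {set {set 'I_n}}) (j : nat) : nat :=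
  #|[set B in P | #|B| == j]|.

Definition hval (h : nat -> nat -> R) (n : nat) (P : {set {set 'I_n}}) : R :=
  \rsum_(j < n.+1 | (0 < j)%nat) h j (kcount P j).

Definition Gcount (g : nat -> nat) (n : nat) : R :=
  \rsum_(P : {set {set 'I_n}} | setpart P) nstruct g P.

Definition En (g : nat -> nat) (n : nat) (f : {set {set 'I_n}} -> R) : R :=
  (\rsum_(P : {set {set 'I_n}} | setpart P) (nstruct g P * f P)) / Gcount g n.

Definition Vn (g : nat -> nat) (n : nat) (f : {set {set 'I_n}} -> R) : R :=
  (\rsum_(P : {set {set 'I_n}} | setpart P)
      (nstruct g P * Rsqr (f P - En g f))) / Gcount g n.

(* Main.v *)
(* Put a_j = lambda_j rho^j and let s be a random count vector drawn from the
   weights prod_j a_j^(s_j) / s_j! conditioned on ell s = n.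

   Call (j, k) good if j is at least a constant K0 and 4 j k <= n.  At most
   K0 + 4 indices j have (j, s_j) not good and s_j > 0, so Cauchy-Schwarz
   handles their contribution.  For the good part, write n = sum_j j s_j and
   remove one part of size j: since j s_j w(s) = j a_j w(s - e_j) and
   j a_j <= Theta, the conditioned second moment about any point c is bounded
   by (Theta / n) times the same moment under the unconditioned, independent
   weights, up to changes of a single summand.  Independence bounds the latter
   by a sum over (j, k) of a_j^k / k! h_j(k)^2, and n Q(n) rho^n
   >= theta' exp(sum a_j) absorbs the total mass.  Finally Q(n) rho^n is at most
   a constant times Q^{j}(n - jk) rho^(n - jk) for good (j, k), because
   q^{j}(m) >= q(m) - a_j q(m - j) with a_j <= Theta / j small,
   where q(m) = Q(m) rho^m and q^{j}(m) = Q^{j}(m) rho^m. *)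
Require Import Defs.
From HB Require Import structures.
From Stdlib Require Import Reals.
From mathcomp Require Import all_boot all_order all_algebra.
From mathcomp Require Import ring lra zify.
From mathcomp Require Import Rstruct.

Set Implicit Arguments.
Unset Strict Implicit.
Unset Printing Implicit Defensive.
Import Order.TTheory GRing.Theory Num.Theory.

(** * Count vectors: adding and removing one part *)

Section CountVectors.
Local Open Scope ring_scope.

Definition upd d (s : {ffun 'I_d -> 'I_d.+1}) (i : 'I_d) (k : 'I_d.+1) :
  {ffun 'I_d -> 'I_d.+1} := [ffun j => if j == i then k else s j].

Definition dec d (i : 'I_d) (s : {ffun 'I_d -> 'I_d.+1}) :=
  upd s i (inord (s i).-1).

(* A junk value when s i = d: [inord] then returns 0. *)
Definition inc d (i : 'I_d) (s : {ffun 'I_d -> 'I_d.+1}) :=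
  upd s i (inord (s i).+1).

Lemma upd_id d (s : {ffun 'I_d -> 'I_d.+1}) (i : 'I_d) : upd s i (s i) = s.
Proof. by apply/ffunP=> j; rewrite ffunE; case: eqP => // ->. Qed.

Lemma upd_upd d (s : {ffun 'I_d -> 'I_d.+1}) i k l :
  upd (upd s i k) i l = upd s i l.
Proof. by apply/ffunP=> j; rewrite !ffunE; case: eqP. Qed.

Lemma upd_eq d (s : {ffun 'I_d -> 'I_d.+1}) i k : upd s i k i = k.
Proof. by rewrite ffunE eqxx. Qed.

Lemma upd_neq d (s : {ffun 'I_d -> 'I_d.+1}) i k j :
  j != i -> upd s i k j = s j.
Proof. by rewrite ffunE => /negbTE ->. Qed.

Lemma ell_upd d (s : {ffun 'I_d -> 'I_d.+1}) i k :
  (ell (upd s i k) + i.+1 * s i = ell s + i.+1 * k)%N.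
Proof.
rewrite /ell (bigD1 i) //= upd_eq [in RHS](bigD1 i) //=.
under eq_bigr => j ji do rewrite upd_neq //.
by rewrite [LHS]addnAC [RHS]addnAC (addnC (_ * k)%N).
Qed.

Lemma leq_ell d (s : {ffun 'I_d -> 'I_d.+1}) (i : 'I_d) : (i.+1 * s i <= ell s)%N.
Proof. by rewrite /ell (bigD1 i) //= leq_addr. Qed.

Lemma leq_count_ell d (s : {ffun 'I_d -> 'I_d.+1}) (i : 'I_d) : (s i <= ell s)%N.
Proof. by apply: leq_trans (leq_ell s i); rewrite leq_pmull. Qed.

Lemma dec_eq d (s : {ffun 'I_d -> 'I_d.+1}) (i : 'I_d) : dec i s i = (s i).-1 :> nat.
Proof.
by rewrite upd_eq inordK //; apply: leq_ltn_trans (leq_pred _) (ltn_ord _).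
Qed.

Lemma inc_eq d (s : {ffun 'I_d -> 'I_d.+1}) (i : 'I_d) :
  (ell s < d)%N -> inc i s i = (s i).+1 :> nat.
Proof.
move=> h; rewrite upd_eq inordK // !ltnS.
exact: leq_ltn_trans (leq_count_ell s i) h.
Qed.

Lemma decK d (s : {ffun 'I_d -> 'I_d.+1}) (i : 'I_d) : (0 < s i)%N -> inc i (dec i s) = s.
Proof.
move=> h; rewrite /inc dec_eq prednK // inord_val /dec upd_upd; exact: upd_id.
Qed.

Lemma incK d (s : {ffun 'I_d -> 'I_d.+1}) (i : 'I_d) :
  (ell s < d)%N -> dec i (inc i s) = s.
Proof.
move=> h; rewrite /dec inc_eq //= inord_val /inc upd_upd; exact: upd_id.
Qed.

Lemma ell_dec d (s : {ffun 'I_d -> 'I_d.+1}) (i : 'I_d) :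
  (0 < s i)%N -> (ell (dec i s) + i.+1 = ell s)%N.
Proof.
move=> h; have := ell_upd s i (inord (s i).-1); rewrite -/(dec i s).
have -> : (inord (s i).-1 : 'I_d.+1) = (s i).-1 :> nat by rewrite -[RHS](dec_eq s i) upd_eq.
by rewrite -[in (_ * s i)%N](prednK h) mulnS addnA => /eqP; rewrite eqn_add2r => /eqP.
Qed.

(** Removing one part of size [i.+1] is a bijection with inverse [inc i]. The bound [m <= d] keeps
    [inc] away from its junk value, and the right-hand condition is additive so that no truncated
    subtraction occurs. *)
Lemma sum_dec (V : nmodType) d (i : 'I_d) m (H : {ffun 'I_d -> 'I_d.+1} -> V) :
  (m <= d)%N ->
  \sum_(s | (ell s == m) && (0 < s i)%N) H (dec i s) =
  \sum_(s | (ell s + i.+1)%N == m) H s.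
Proof.
move=> md; symmetry.
rewrite (reindex_onto (dec i) (inc i)) /=; last first.
  move=> s /eqP e; rewrite incK //; apply: leq_trans md.
  by rewrite -e addnS ltnS leq_addr.
apply: eq_bigl => s; case: (posnP (s i)) => [s0|sp]; last first.
  by rewrite decK // eqxx ell_dec // !andbT.
rewrite andbF; apply/negbTE/negP => /andP[/eqP e1 /eqP e2].
have : (0 < inc i (dec i s) i)%N.
  rewrite inc_eq //; apply: leq_trans md.
  by rewrite -e1 addnS ltnS leq_addr.
by rewrite e2 s0.
Qed.

Lemma ell0 d (s : {ffun 'I_d -> 'I_d.+1}) : (ell s == 0%N) = (s == [ffun=> ord0]).
Proof.
apply/idP/eqP => [|->]; last first.
  by rewrite /ell big1 // => i _; rewrite ffunE muln0.
rewrite /ell sum_nat_eq0 => /forallP h; apply/ffunP => i; apply: val_inj.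
by have := h i; rewrite ffunE /= muln_eq0 /= => /eqP.
Qed.

(** * Weights of count vectors and their recursions *)

Section Weights.
Variable F : realFieldType.
Implicit Types (a : nat -> F) (d m n j : nat).

Definition wt a d (s : {ffun 'I_d -> 'I_d.+1}) : F :=
  \prod_(i < d) (a i.+1 ^+ s i / (s i)`!%:R).

(** For [m <= d] this is the coefficient of z^m in exp(sum_j a_j z^j). The dimension [d] only bounds
    indices and counts, and [mass_dim] lets it vary. *)
Definition mass a d m : F :=
  \sum_(s : {ffun 'I_d -> 'I_d.+1} | ell s == m) wt a s.

(* Since 0 ^+ 0 = 1, setting a_j to 0 keeps exactly the vectors with s_j = 0. *)
Definition excl a j : nat -> F := fun i => if i == j then 0 else a i.

Lemma wt_ge0 a d (s : {ffun 'I_d -> 'I_d.+1}) : (forall i, 0 <= a i) -> 0 <= wt a s.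
Proof. by move=> a0; apply: prodr_ge0 => i _; rewrite divr_ge0 ?exprn_ge0. Qed.

Lemma mass_ge0 a d m : (forall i, 0 <= a i) -> 0 <= mass a d m.
Proof. by move=> a0; apply: sumr_ge0 => s _; exact: wt_ge0. Qed.

(** Only the [i]-th factor changes, by k * a^k / k! = a * a^(k-1) / (k-1)!. *)
Lemma wt_dec a d (s : {ffun 'I_d -> 'I_d.+1}) (i : 'I_d) : (0 < s i)%N ->
  (s i)%:R * wt a s = a i.+1 * wt a (dec i s).
Proof.
move=> h; rewrite /wt (bigD1 i) //= [in RHS](bigD1 i) //= dec_eq !mulrA.
congr (_ * _); last by apply: eq_bigr => j ji; rewrite upd_neq.
case: (nat_of_ord (s i)) h => // k _.
rewrite factS natrM exprS invfM /=; field.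
by rewrite nat1r !pnatr_eq0 -lt0n fact_gt0.
Qed.

(** Write m as the sum of the [i.+1 * s i] and apply [wt_dec] to each term. The argument of [G]
    stays at [s], while the weight moves to [dec i s]. *)
Lemma size_bias a d m (G : {ffun 'I_d -> 'I_d.+1} -> F) :
  m%:R * \sum_(s | ell s == m) wt a s * G s =
  \sum_(i < d) \sum_(s | (ell s == m) && (0 < s i)%N)
    i.+1%:R * a i.+1 * (wt a (dec i s) * G s).
Proof.
transitivity (\sum_(s : {ffun 'I_d -> 'I_d.+1} | ell s == m)
    \sum_(i < d | (0 < s i)%N) i.+1%:R * a i.+1 * (wt a (dec i s) * G s)).
  rewrite mulr_sumr; apply: eq_bigr => s /eqP <-.
  rewrite /ell natr_sum mulr_suml (bigID (fun i : 'I_d => (0 < s i)%N)) /=.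
  rewrite [X in _ + X]big1 ?addr0 => [|i]; last first.
    by rewrite -eqn0Ngt => /eqP ->; rewrite muln0 mul0r.
  apply: eq_bigr => i si.
  by rewrite natrM !mulrA -[_ * wt a s]mulrA wt_dec // !mulrA.
by rewrite (exchange_big_dep predT).
Qed.

(** The case [G = 1] of [size_bias]. This recursion determines the masses, which gives
    [mass_dim]. *)
Lemma mass_rec a d m : (m <= d)%N ->
  m%:R * mass a d m = \sum_(i < d | (i < m)%N) i.+1%:R * a i.+1 * mass a d (m - i.+1).
Proof.
move=> md; have := size_bias a m (fun _ : {ffun 'I_d -> 'I_d.+1} => 1).
under eq_bigr do rewrite mulr1.
rewrite -/(mass a d m) => ->.
rewrite [RHS]big_mkcond /=; apply: eq_bigr => i _.
under eq_bigr do rewrite mulr1.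
rewrite -mulr_sumr sum_dec //.
case: ltnP => im; last first.
  rewrite big_pred0 ?mulr0 // => s; apply/negbTE/eqP => e.
  by have := leq_addl (ell s) i.+1; rewrite e leqNgt ltnS im.
by congr (_ * _); apply: eq_bigl => s; rewrite -[in LHS](subnK im) eqn_add2r.
Qed.

Lemma mass0 a d : mass a d 0 = 1.
Proof.
rewrite /mass (big_pred1 [ffun=> ord0]) => [|s]; last exact: ell0.
by rewrite /wt big1 // => i _; rewrite ffunE expr0 divr1.
Qed.

Lemma mass_dim a d d' m : (m <= d)%N -> (m <= d')%N -> mass a d m = mass a d' m.
Proof.
move: d d'; elim/ltn_ind: m => m IH d d' md md'.
case: (posnP m) => [->|m0]; first by rewrite !mass0.
have aux e : (m <= e)%N -> m%:R * mass a e m =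
    \sum_(i < m) i.+1%:R * a i.+1 * mass a m (m - i.+1).
  move=> me; rewrite mass_rec //.
  rewrite (big_ord_widen e (fun i => i.+1%:R * a i.+1 * mass a m (m - i.+1))) //.
  apply: eq_bigr => i im; congr (_ * _); apply: IH; lia.
have m1 : m%:R != 0 :> F by rewrite pnatr_eq0 -lt0n.
by apply: (mulfI m1); rewrite !aux.
Qed.

(** Resetting the [i]-th count from [k] to 0 is a bijection that divides the weight by a^k / k!.
    This produces the terms on the right of the main inequality. *)
Lemma mass_fiber a n (i : 'I_n) k : (i.+1 * k <= n)%N ->
  \sum_(s : {ffun 'I_n -> 'I_n.+1} | (ell s == n) && (s i == k :> nat)) wt a s =
  a i.+1 ^+ k / k`!%:R * mass (excl a i.+1) n (n - i.+1 * k).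
Proof.
move=> ikn; have kn : (k < n.+1)%N by rewrite ltnS; apply: leq_trans ikn; rewrite leq_pmull.
pose K := Ordinal kn.
transitivity (\sum_(s : {ffun 'I_n -> 'I_n.+1} |
    (ell s == n - i.+1 * k)%N && (s i == ord0)) wt a (upd s i K)).
  rewrite (reindex_onto (fun s => upd s i K) (fun s => upd s i ord0)) /=; last first.
    by move=> s /andP[_ /eqP e]; rewrite upd_upd -[RHS](upd_id s i); congr upd; apply: val_inj.
  apply: eq_bigl => s; rewrite upd_eq eqxx andbT upd_upd.
  have -> : (upd s i ord0 == s) = (s i == ord0).
    apply/eqP/eqP => [<-|e]; first by rewrite upd_eq.
    by rewrite -e upd_id.
  case: (s i =P ord0) => [e|]; rewrite ?andbF // !andbT.
  have := ell_upd s i K; rewrite e /= muln0 addn0 => ->.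
  by rewrite -[in RHS](eqn_add2r (i.+1 * k)) subnK.
rewrite /mass mulr_sumr.
rewrite [RHS](bigID (fun s : {ffun 'I_n -> 'I_n.+1} => s i == ord0)) /=.
rewrite [X in _ = _ + X]big1 ?addr0 => [|s /andP[_ si]]; last first.
  rewrite /wt (bigD1 i) //= /excl eqxx expr0n.
  have -> : (s i == 0%N :> nat) = false by apply/negbTE.
  by rewrite /= !mul0r mulr0.
apply: eq_bigr => s /andP[_ /eqP si].
rewrite /wt (bigD1 i) //= upd_eq [in RHS](bigD1 i) //= si expr0 divr1 mul1r.
congr (_ * _); apply: eq_bigr => j ji; rewrite upd_neq // /excl eqSS.
by rewrite (inj_eq val_inj) (negbTE ji).
Qed.

Lemma mass_excl_forall a j n m :
  mass (excl a j) n m = \sum_(s : {ffun 'I_n -> 'I_n.+1} |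
    (ell s == m) && [forall i : 'I_n, (i.+1 == j) ==> (s i == 0%N :> nat)]) wt a s.
Proof.
rewrite /mass big_mkcondr /=; apply: eq_bigr => s _.
case: ifP => [/forallP h|/negbT]; last first.
  rewrite negb_forall => /existsP[i]; rewrite negb_imply => /andP[ij si].
  by rewrite /wt (bigD1 i) //= /excl ij expr0n (negbTE si) /= !mul0r.
apply: eq_bigr => i _; rewrite /excl; case: ifP => // ij.
by have := h i; rewrite ij => /eqP ->; rewrite !expr0.
Qed.

Lemma mass_excl a n (i : 'I_n) m :
  mass (excl a i.+1) n m =
  \sum_(s : {ffun 'I_n -> 'I_n.+1} | (ell s == m) && (s i == 0%N :> nat)) wt a s.
Proof.
rewrite mass_excl_forall; apply: eq_bigl => s; congr (_ && _).
apply/forallP/idP => [/(_ i)|si j]; first by rewrite eqxx.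
by apply/implyP; rewrite eqSS => /eqP/val_inj ->.
Qed.

(** The difference to the full mass comes from vectors with [s i > 0]. For these the weight is at
    most [s i] times itself, which is a_j times the weight of [dec i s], where j is [i.+1]. *)
Lemma mass_excl_ge a n (i : 'I_n) m : (forall j, 0 <= a j) -> (i < m)%N -> (m <= n)%N ->
  mass a n m - a i.+1 * mass a n (m - i.+1) <= mass (excl a i.+1) n m.
Proof.
move=> a0 im mn; rewrite mass_excl /mass.
rewrite [X in X - _](bigID (fun s : {ffun 'I_n -> 'I_n.+1} => s i == 0%N :> nat)) /=.
rewrite lerBlDr lerD2l.
under eq_bigl do rewrite -lt0n.
rewrite mulr_sumr.
have := sum_dec i (fun s => a i.+1 * wt a s) mn.
under [X in _ = X -> _]eq_bigl => s do rewrite -[X in _ == X](subnK im) eqn_add2r.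
move=> <-; apply: ler_sum => s /andP[_ si].
rewrite -wt_dec // ler_peMl ?wt_ge0 //.
by rewrite (ler_nat _ 1).
Qed.

End Weights.
End CountVectors.

(** * Second moments under an unnormalised product measure *)

Section ProductMeasure.
Local Open Scope ring_scope.
Variables (F : realFieldType) (I K : finType) (b : I -> K -> F).

Lemma sum_prod_one (i : I) (f : K -> F) :
  \sum_(s : {ffun I -> K}) (\prod_l b l (s l)) * f (s i) =
  (\prod_(l | l != i) \sum_k b l k) * \sum_k b i k * f k.
Proof.
pose c l k := b l k * (if l == i then f k else 1).
transitivity (\prod_l \sum_k c l k).
  rewrite bigA_distr_bigA; apply: eq_bigr => s _; rewrite big_split /=.
  by congr (_ * _); rewrite -big_mkcond big_pred1_eq.
rewrite (bigD1 i) //= mulrC; congr (_ * _).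
  by apply: eq_bigr => l /negbTE li; apply: eq_bigr => k _; rewrite /c li mulr1.
by apply: eq_bigr => k _; rewrite /c eqxx.
Qed.

(** Independence: the sum factors over coordinates, and the factor at [i] is the centred sum of
    [f]. *)
Lemma sum_prod_two (i j : I) (f g : K -> F) : i != j ->
  \sum_k b i k * f k = 0 ->
  \sum_(s : {ffun I -> K}) (\prod_l b l (s l)) * (f (s i) * g (s j)) = 0.
Proof.
move=> ij f0.
pose c l k := b l k * ((if l == i then f k else 1) * (if l == j then g k else 1)).
transitivity (\prod_l \sum_k c l k).
  rewrite bigA_distr_bigA; apply: eq_bigr => s _; rewrite !big_split /=.
  by congr (_ * (_ * _)); rewrite -big_mkcond big_pred1_eq.
rewrite (bigD1 i) //= (_ : \sum_k _ = 0) ?mul0r // -[RHS]f0.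
by apply: eq_bigr => k _; rewrite /c eqxx (negbTE ij) mulr1.
Qed.

Hypothesis b_ge0 : forall i k, 0 <= b i k.
Hypothesis b_ge1 : forall i, 1 <= \sum_k b i k.
Let W := \prod_i \sum_k b i k.

(** Each coordinate brings the product of the other total masses; as every total mass is at least 1,
    this is at most [W]. *)
Lemma sum_prod_le (x : I -> K -> F) : (forall i k, 0 <= x i k) ->
  \sum_(s : {ffun I -> K}) (\prod_l b l (s l)) * \sum_i x i (s i) <=
  W * \sum_i \sum_k b i k * x i k.
Proof.
move=> x0; under eq_bigr do rewrite mulr_sumr.
rewrite exchange_big /= mulr_sumr; apply: ler_sum => i _.
rewrite sum_prod_one /W [X in _ <= X * _](bigD1 i) //= -mulrA ler_peMl // mulrC.
apply: mulr_ge0; first by apply: sumr_ge0 => k _; rewrite mulr_ge0.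
by apply: prodr_ge0 => l _; apply: sumr_ge0.
Qed.

(** The centre [c] is the sum of the coordinate means. Centring kills the cross terms and does not
    increase the second moment of any coordinate. *)
Lemma product_variance_le (x : I -> K -> F) :
  exists c, \sum_(s : {ffun I -> K}) (\prod_l b l (s l)) * (\sum_i x i (s i) - c) ^+ 2
    <= W * \sum_i \sum_k b i k * x i k ^+ 2.
Proof.
pose z i := \sum_k b i k; pose mu i := (\sum_k b i k * x i k) / z i.
have z0 i : z i != 0 by apply: lt0r_neq0; apply: lt_le_trans (b_ge1 i).
pose y i k := x i k - mu i.
have y0 i : \sum_k b i k * y i k = 0.
  under eq_bigr do rewrite mulrBr.
  by rewrite big_split /= sumrN -mulr_suml -/(z i) mulrC divfK // subrr.
have yx i : \sum_k b i k * y i k ^+ 2 <= \sum_k b i k * x i k ^+ 2.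
  have -> : \sum_k b i k * x i k ^+ 2 = \sum_k b i k * y i k ^+ 2 +
      2 * mu i * (\sum_k b i k * y i k) + mu i ^+ 2 * z i.
    rewrite /z !mulr_sumr -!big_split /=; apply: eq_bigr => k _; rewrite /y; ring.
  rewrite y0 mulr0 addr0 lerDl mulr_ge0 ?sqr_ge0 //.
  exact: le_trans (b_ge1 i).
exists (\sum_i mu i); apply: le_trans (_ : W * \sum_i \sum_k b i k * y i k ^+ 2 <= _); last first.
  apply: ler_wpM2l; last exact: ler_sum.
  by apply: prodr_ge0 => l _; apply: sumr_ge0.
apply: le_trans (sum_prod_le (fun i k => sqr_ge0 (y i k))).
(* This is in fact an equality: after expanding the square, the off-diagonal terms vanish by
   [sum_prod_two]. *)
rewrite le_eqVlt; apply/orP; left; apply/eqP.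
under eq_bigr => s do rewrite -sumrB expr2 mulr_suml mulr_sumr.
under [RHS]eq_bigr => s do rewrite mulr_sumr.
rewrite exchange_big [RHS]exchange_big /=; apply: eq_bigr => i _.
under eq_bigr => s do rewrite !mulr_sumr.
rewrite exchange_big /= (bigD1 i) //= [X in _ + X]big1 ?addr0 // => j ji.
by rewrite (@sum_prod_two i j (y i) (y j)) // eq_sym.
Qed.

End ProductMeasure.

(** * From the conditioned measure to the product measure *)

Section VarianceBound.
Local Open Scope ring_scope.
Variable F : realFieldType.

(** Expand the nonnegative double sum of [(v i - v j) ^+ 2] over [B]. *)
Lemma sqr_sum_le_card (I : finType) (B : {set I}) (v : I -> F) :
  (\sum_(i in B) v i) ^+ 2 <= #|B|%:R * \sum_(i in B) v i ^+ 2.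
Proof.
have : 0 <= \sum_(i in B) \sum_(j in B) (v i - v j) ^+ 2.
  by apply: sumr_ge0 => i _; apply: sumr_ge0 => j _; exact: sqr_ge0.
set S := \sum_(i in B) v i; set T := \sum_(i in B) v i ^+ 2.
have E i : \sum_(j in B) (v i - v j) ^+ 2 = #|B|%:R * v i ^+ 2 - 2 * S * v i + T.
  under eq_bigr do rewrite sqrrB.
  rewrite big_split sumrB /= sumr_const sumrMnl -mulr_sumr -/S -/T.
  rewrite -[_ *+ #|B|]mulr_natl; ring.
under eq_bigr do rewrite E.
rewrite big_split sumrB /= sumr_const -!mulr_sumr -/S -/T -[T *+ _]mulr_natl.
have -> : #|B|%:R * T - 2 * S * S + #|B|%:R * T = 2 * (#|B|%:R * T - S ^+ 2) by ring.
by rewrite pmulr_rge0 // subr_ge0.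
Qed.

(** A vector reached by removing a part of size [i.+1] satisfies [ell s + i.+1 = n], so it
    determines [i] and is reached at most once. This is what removes the conditioning on [ell]. *)
Lemma sum_dec_le n (H : {ffun 'I_n -> 'I_n.+1} -> F) : (forall s, 0 <= H s) ->
  \sum_(i < n) \sum_(s | (ell s == n) && (0 < s i)%N) H (dec i s) <= \sum_s H s.
Proof.
move=> H0; under eq_bigr => i _ do rewrite sum_dec //.
rewrite (exchange_big_dep predT) //=; apply: ler_sum => s _.
rewrite sumr_const -[leRHS]mulr1n ler_wpMn2l //.
apply/card_le1_eqP => i j /eqP ei /eqP ej; apply/val_inj/eqP.
by rewrite -eqSS -(eqn_add2l (ell s)) ei ej.
Qed.


(** Combine [size_bias] for [G = 1], the bound j a_j <= Theta, and [sum_dec_le]. *)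
Lemma mass_le (a : nat -> F) n Theta : (forall i, 0 <= a i) ->
  (forall i, i.+1%:R * a i.+1 <= Theta) ->
  n%:R * mass a n n <= Theta * \prod_(i < n) \sum_(k < n.+1) (a i.+1 ^+ k / k`!%:R).
Proof.
move=> a0 aT; have T0 : 0 <= Theta by apply: le_trans (aT 0%N); rewrite mulr_ge0.
have := size_bias a n (fun _ : {ffun 'I_n -> 'I_n.+1} => 1).
under eq_bigr do rewrite mulr1.
rewrite -/(mass a n n) => ->.
rewrite bigA_distr_bigA /= -/(wt a).
apply: le_trans (ler_wpM2l T0 (@sum_dec_le n (wt a (d:=n)) (fun s => wt_ge0 s a0))).
rewrite mulr_sumr; apply: ler_sum => i _; rewrite mulr_sumr.
by apply: ler_sum => s _; rewrite mulr1 ler_wpM2r // wt_ge0.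
Qed.

(** After size-biasing, removing the part alters a single summand of the additive function. The
    function of the shortened vector is handled by the product measure, which also supplies [c]; the
    two values of the altered summand are bounded separately. *)
Lemma size_biased_variance (a : nat -> F) n Theta (x : 'I_n -> nat -> F) :
  (forall i, 0 <= a i) -> (forall i, i.+1%:R * a i.+1 <= Theta) ->
  exists c, n%:R * \sum_(s | ell s == n) wt a s * (\sum_i x i (s i) - c) ^+ 2 <=
    3 * n%:R * (\sum_(s | ell s == n) wt a s * \sum_i x i (s i) ^+ 2) +
    6 * Theta * (\prod_(i < n) \sum_(k < n.+1) (a i.+1 ^+ k / k`!%:R)) *
      \sum_(i < n) \sum_(k < n.+1) (a i.+1 ^+ k / k`!%:R) * x i k ^+ 2.
Proof.
move=> a0 aT; have T0 : 0 <= Theta by apply: le_trans (aT 0%N); rewrite mulr_ge0.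
pose b (i : 'I_n) (k : 'I_n.+1) := a i.+1 ^+ k / k`!%:R.
have b0 i k : 0 <= b i k by rewrite divr_ge0 ?exprn_ge0.
have b1 i : 1 <= \sum_k b i k.
  rewrite big_ord_recl {1}/b expr0 divr1 lerDl; exact: sumr_ge0.
have [c hc] := product_variance_le b0 b1 (fun i k => x i k).
have hx := sum_prod_le b0 b1 (fun i k => sqr_ge0 (x i (nat_of_ord k))).
exists c; rewrite size_bias.
set U := fun s : {ffun 'I_n -> 'I_n.+1} => \sum_i x i (s i).
set V := fun s : {ffun 'I_n -> 'I_n.+1} => \sum_i x i (s i) ^+ 2.
pose H s := 3 * (wt a s * ((U s - c) ^+ 2 + V s)).
have H0 s : 0 <= H s.
  by rewrite /H !mulr_ge0 ?wt_ge0 // addr_ge0 ?sqr_ge0 // sumr_ge0 // => i _; exact: sqr_ge0.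
have step (i : 'I_n) (s : {ffun 'I_n -> 'I_n.+1}) : (0 < s i)%N ->
    i.+1%:R * a i.+1 * (wt a (dec i s) * (U s - c) ^+ 2) <=
    Theta * H (dec i s) + 3 * (wt a s * ((i.+1 * s i)%:R * x i (s i) ^+ 2)).
  move=> si; have -> : U s = U (dec i s) + x i (s i) - x i (dec i s i).
    rewrite /U (bigD1 i) //= [in RHS](bigD1 i) //=.
    under [in RHS]eq_bigr => j ji do rewrite upd_neq //.
    by ring.
  have Vge : x i (dec i s i) ^+ 2 <= V (dec i s).
    by rewrite /V (bigD1 i) //= lerDl sumr_ge0 // => j _; exact: sqr_ge0.
  (* The old value [x i (s i)] is charged to [s] itself by reading [wt_dec] backwards. *)
  have -> : wt a s * ((i.+1 * s i)%:R * x i (s i) ^+ 2) =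
      i.+1%:R * a i.+1 * (wt a (dec i s) * x i (s i) ^+ 2).
    by rewrite natrM; have := wt_dec a si => e; ring: e.
  have w0 := wt_ge0 (dec i s) a0.
  have sq : (U (dec i s) + x i (s i) - x i (dec i s i) - c) ^+ 2 <=
      3 * ((U (dec i s) - c) ^+ 2 + V (dec i s)) + 3 * x i (s i) ^+ 2.
    set p := U _; set q := x i (s i); set r := x i _ in Vge *; set v := V _ in Vge *.
    have e1 := sqr_ge0 (p - c - q); have e2 := sqr_ge0 (p - c + r).
    have e3 := sqr_ge0 (q + r).
    (* The square of a sum of three terms is at most three times the sum of their squares; the
       defect is written explicitly as a sum of squares. *)
    have -> : (p + q - r - c) ^+ 2 = 3 * ((p - c) ^+ 2 + r ^+ 2) + 3 * q ^+ 2
        - ((p - c - q) ^+ 2 + (p - c + r) ^+ 2 + (q + r) ^+ 2) by ring.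
    lra.
  have ia0 : 0 <= i.+1%:R * a i.+1 by rewrite mulr_ge0.
  apply: le_trans (ler_wpM2l ia0 (ler_wpM2l w0 sq)) _.
  rewrite !mulrDr; apply: lerD; last by rewrite le_eqVlt; apply/orP; left; apply/eqP; ring.
  rewrite -!mulrDr /H [wt a _ * (3 * _)]mulrCA; apply: ler_wpM2r => //; exact: H0.
apply: le_trans (_ : \sum_(i < n) \sum_(s | (ell s == n) && (0 < s i)%N)
   (Theta * H (dec i s) + 3 * (wt a s * ((i.+1 * s i)%:R * x i (s i) ^+ 2))) <= _).
  by apply: ler_sum => i _; apply: ler_sum => s /andP[_]; exact: step.
under eq_bigr do rewrite big_split /= -mulr_sumr.
rewrite big_split /= -mulr_sumr addrC; apply: lerD.
  rewrite (exchange_big_dep (fun s => ell s == n)) /=; last by move=> i s _ /andP[].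
  rewrite -mulrA mulr_sumr mulr_sumr; apply: ler_sum => s /eqP es.
  rewrite -!mulr_sumr ler_wpM2l // mulrCA ler_wpM2l ?wt_ge0 //.
  rewrite mulr_sumr [leLHS]big_mkcond; apply: ler_sum => i _.
  case: ifP => _; last by rewrite mulr_ge0 ?sqr_ge0.
  by rewrite ler_wpM2r ?sqr_ge0 // ler_nat -[leqRHS]es leq_ell.
apply: le_trans (ler_wpM2l T0 (sum_dec_le H0)) _.
rewrite /H -mulr_sumr.
under [X in _ * (3 * X)]eq_bigr do rewrite mulrDr.
rewrite big_split /=.
(* The 3 is from the three-term square; the 2 counts the variance bound [hc] and the second-moment
   bound [hx], which have the same right side. *)
have -> : 6 * Theta = Theta * 3 * 2 by ring.
rewrite mulrA -!mulrA ler_wpM2l // ler_wpM2l // mulr_natl mulr2n.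
exact: lerD hc hx.
Qed.

End VarianceBound.

(** * The Turan-Kubilius inequality for count vectors *)

Section TuranKubilius.
Local Open Scope ring_scope.
Variable F : realFieldType.

(** Split by the value [k] of [s i] and use [mass_fiber]; the fibre is empty when [i.+1 * k > n]. *)
Lemma sum_wt_additive (a : nat -> F) n (f : 'I_n -> nat -> F) :
  \sum_(s | ell s == n) wt a s * \sum_i f i (s i) =
  \sum_(i < n) \sum_(k < n.+1 | (i.+1 * k <= n)%N)
    a i.+1 ^+ k / k`!%:R * mass (excl a i.+1) n (n - i.+1 * k) * f i k.
Proof.
under eq_bigr do rewrite mulr_sumr.
rewrite exchange_big /=; apply: eq_bigr => i _.
rewrite (partition_big (fun s : {ffun 'I_n -> 'I_n.+1} => s i) predT) //=.
rewrite [RHS]big_mkcond /=; apply: eq_bigr => k _.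
case: ifP => ikn.
  rewrite -mass_fiber // mulr_suml; apply: eq_big => // s /andP[_ /eqP ->] //.
apply: big1 => s /andP[/eqP e /eqP sk].
by have := leq_ell s i; rewrite e sk ikn.
Qed.

(** Each counted index contributes more than n to the sum of the [c * (i.+1 * s i)], whose total is
    c n. *)
Lemma card_large_parts n (s : {ffun 'I_n -> 'I_n.+1}) (c : nat) :
  (0 < n)%N -> ell s = n -> (#|[set i : 'I_n | n < c * (i.+1 * s i)]| <= c)%N.
Proof.
move=> n0 es; rewrite -(leq_pmul2r n0).
rewrite -[X in (_ <= _ * X)%N]es /ell big_distrr /= -sum_nat_const.
rewrite [leqRHS](bigID (fun i => i \in [set i : 'I_n | (n < c * (i.+1 * s i))%N])) /=.
apply: leq_trans (leq_addr _ _); apply: leq_sum => i; rewrite inE; exact: ltnW.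
Qed.

Lemma card_small_ord n m : (#|[set i : 'I_n | i.+1 < m]| <= m)%N.
Proof.
rewrite -sum1_card (eq_bigl (fun i : 'I_n => i.+1 < m)%N) => [|i]; last by rewrite inE.
rewrite -(big_mkord (fun i => i.+1 < m)%N (fun=> 1%N)) sum1_count -size_filter.
rewrite -[X in (_ <= X)%N](size_iota 0); apply: uniq_leq_size.
  by rewrite filter_uniq ?iota_uniq.
by move=> i; rewrite mem_filter !mem_iota => /andP[/ltnW].
Qed.

(** [E m] stands for exp(a_1 + ... + a_m) and [K] for exp(Theta). Keeping them abstract lets the
    argument run over any ordered field. *)
Variables (a E : nat -> F) (Theta theta' K : F).
Hypothesis a_ge0 : forall i, 0 <= a i.
Hypothesis a_le : forall i, i.+1%:R * a i.+1 <= Theta.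
Hypothesis theta'_gt0 : 0 < theta'.
Hypothesis K_gt0 : 0 < K.
Hypothesis E_ge_weights :
  forall m, \prod_(i < m) \sum_(k < m.+1) (a i.+1 ^+ k / k`!%:R) <= E m.
Hypothesis E_mono : forall m n, (m <= n)%N -> E m <= E n.
Hypothesis E_doubling : forall m n, (n <= 2 * m)%N -> E n <= K * E m.
Hypothesis E_le_mass : forall m, (0 < m)%N -> theta' * E m <= m%:R * mass a m m.

(** With m = n - jk, the upper bound [mass_le] at n, the doubling of [E] and the lower bound at m
    compare q(n) with q(m). Excluding size j then costs at most half of q(m). *)
Lemma mass_ratio n (i : 'I_n) k : (0 < k)%N -> (4 * (i.+1 * k) <= n)%N ->
  4 * Theta ^+ 2 * K <= theta' * i.+1%:R ->
  theta' * mass a n n <= 2 * Theta * K * mass (excl a i.+1) n (n - i.+1 * k).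
Proof.
move=> k0 ikn hi; have T0 : 0 <= Theta by apply: le_trans (a_le 0%N); rewrite mulr_ge0.
have ik : (i.+1 <= i.+1 * k)%N by rewrite leq_pmulr.
(* Since 4jk <= n and k >= 1, we have m >= 3n/4 and p >= n/2, which gives all the comparisons
   below. *)
set j := i.+1 in hi ik ikn *; pose m := (n - j * k)%N; pose p := (m - j)%N.
have [m0 p0 mn pm pn] : [/\ 0 < m, 0 < p, m <= n, p <= m & p <= n]%N.
  by rewrite /p /m; split; lia.
have [jm m2p n2m] : [/\ i < m, m <= 2 * p & n <= 2 * m]%N.
  by rewrite /p /m; split; lia.
have ex := mass_excl_ge a_ge0 jm mn; rewrite -/j -/p in ex.
rewrite (mass_dim _ mn (leqnn m)) (mass_dim _ (leq_trans pm mn) (leqnn p)) in ex.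
rewrite -/m; set X := mass (excl _ _) _ _ in ex *.
clearbody m p.
have up q : q%:R * mass a q q <= Theta * E q.
  by apply: le_trans (mass_le q a_ge0 a_le) _; rewrite ler_wpM2l.
have low := E_le_mass m0.
have nK := E_doubling n2m.
have en : theta' * (Theta * E n) <= Theta * K * (m%:R * mass a m m).
  apply: le_trans (_ : Theta * K * (theta' * E m) <= _); last first.
    by rewrite ler_wpM2l // mulr_ge0 // ltW.
  have -> : Theta * K * (theta' * E m) = theta' * (Theta * (K * E m)) by ring.
  by rewrite ler_wpM2l ?(ltW theta'_gt0) // ler_wpM2l.
have mm0 := mass_ge0 m m a_ge0; have mp0 := mass_ge0 p p a_ge0.
have TK0 : 0 <= Theta * K by rewrite mulr_ge0 // ltW.
have m2pR : m%:R <= 2 * p%:R :> F by rewrite -natrM ler_nat.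
have mnR : m%:R <= n%:R :> F by rewrite ler_nat.
have hp : theta' * mass a p p <= 2 * Theta * K * mass a m m.
  have p1 : 0 < p%:R :> F by rewrite ltr0n.
  rewrite -(ler_pM2l p1).
  have h1 : theta' * (p%:R * mass a p p) <= theta' * (Theta * E n).
    rewrite ler_wpM2l ?(ltW theta'_gt0) //; apply: le_trans (up p) _.
    exact: (ler_wpM2l T0 (E_mono pn)).
  have h2 : Theta * K * (m%:R * mass a m m) <= Theta * K * (2 * p%:R * mass a m m).
    by rewrite ler_wpM2l // ler_wpM2r.
  by rewrite mulrCA; apply: le_trans h1 (le_trans en (le_trans h2 _));
    rewrite le_eqVlt; apply/orP; left; apply/eqP; ring.
have hn : theta' * mass a n n <= Theta * K * mass a m m.
  have n1 : 0 < n%:R :> F by rewrite ltr0n (leq_trans m0).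
  rewrite -(ler_pM2l n1) mulrCA.
  apply: le_trans (_ : theta' * (Theta * E n) <= _).
    by rewrite ler_wpM2l ?(ltW theta'_gt0) // up.
  apply: le_trans en _; rewrite mulrCA ler_wpM2r //.
  by rewrite mulr_ge0.
(* From j a_j <= Theta and [hp], theta' j a_j q(p) <= 2 Theta^2 K q(m), and the lower bound [hi] on
   j makes this at most half of theta' j q(m). *)
have ha : a j * mass a p p <= mass a m m / 2.
  have c0 : 0 < theta' * j%:R by rewrite mulr_gt0 // ltr0n.
  rewrite -(ler_pM2l c0).
  apply: le_trans (_ : Theta * (2 * Theta * K * mass a m m) <= _).
    apply: le_trans (_ : Theta * (theta' * mass a p p) <= _); last by rewrite ler_wpM2l.
    have -> : theta' * j%:R * (a j * mass a p p) = j%:R * a j * (theta' * mass a p p) by ring.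
    by apply: ler_wpM2r (a_le i); rewrite mulr_ge0 // ltW.
  have := ler_wpM2r mm0 hi; lra.
apply: le_trans hn _; have : mass a m m <= 2 * X by lra.
by move=> /(ler_wpM2l TK0); lra.
Qed.

(** The good part [y] goes through [size_biased_variance] and [mass_ratio], the rest [z] through
    Cauchy-Schwarz. The outer factors 2 come from splitting the square of their sum. *)
Lemma turan_kubilius_vectors n (K0 : nat) (x : 'I_n -> nat -> F) :
  (0 < n)%N -> (forall i, x i 0%N = 0) ->
  4 * Theta ^+ 2 * K <= theta' * K0%:R ->
  exists c, \sum_(s | ell s == n) wt a s * (\sum_i x i (s i) - c) ^+ 2 <=
   (2 * (3 + 12 * Theta ^+ 2 * K / theta' ^+ 2) + 2 * (K0 + 4)%:R) *
   \sum_(s | ell s == n) wt a s * \sum_i x i (s i) ^+ 2.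
Proof.
move=> n0 x0 hK0; have T0 : 0 <= Theta by apply: le_trans (a_le 0%N); rewrite mulr_ge0.
pose good (i : 'I_n) k := [&& (0 < k), (4 * (i.+1 * k) <= n) & (K0 <= i.+1)]%N.
pose y i k := if good i k then x i k else 0.
pose z i k := if good i k then 0 else x i k.
have xyz i k : x i k = y i k + z i k.
  by rewrite /y /z; case: ifP; rewrite ?addr0 ?add0r.
set S := \sum_(s | _) wt a s * \sum_i x i (s i) ^+ 2.
have yx i k : y i k ^+ 2 <= x i k ^+ 2.
  by rewrite /y; case: ifP => // _; rewrite expr0n sqr_ge0.
have Sy : \sum_(s | ell s == n) wt a s * \sum_i y i (s i) ^+ 2 <= S.
  by apply: ler_sum => s _; rewrite ler_wpM2l ?wt_ge0 // ler_sum.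
have zS s : ell s = n -> (\sum_i z i (s i)) ^+ 2 <= (K0 + 4)%:R * \sum_i x i (s i) ^+ 2.
  (* Outside [B] an index is good unless its count is 0, and then [x0] makes it contribute
     nothing. *)
  move=> es; pose B := [set i : 'I_n | i.+1 < K0]%N :|: [set i : 'I_n | n < 4 * (i.+1 * s i)]%N.
  have -> : \sum_i z i (s i) = \sum_(i in B) z i (s i).
    rewrite [RHS]big_mkcond; apply: eq_bigr => i _; case: ifP => // /negbT.
    rewrite !inE negb_or -!leqNgt => /andP[h1 h2]; rewrite /z /good h1 h2 !andbT.
    by case: posnP => // ->.
  apply: le_trans (sqr_sum_le_card _ _) _.
  apply: ler_pM => //; first by apply: sumr_ge0 => i _; exact: sqr_ge0.
    rewrite ler_nat; apply: leq_trans (leq_card_setU _ _) _.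
    by apply: leq_add; [exact: card_small_ord | exact: card_large_parts].
  rewrite [leLHS]big_mkcond /=; apply: ler_sum => i _.
  case: ifP => _; last exact: sqr_ge0.
  by rewrite /z; case: ifP => // _; rewrite expr0n sqr_ge0.
have [c hc] := size_biased_variance y a_ge0 a_le.
exists c.
have hy : \sum_(s | ell s == n) wt a s * (\sum_i y i (s i) - c) ^+ 2 <=
    (3 + 12 * Theta ^+ 2 * K / theta' ^+ 2) * S.
  set W := \prod_(i < n) _ in hc; set D := \sum_(i < n) _ in hc.
  have D0 : 0 <= D.
    apply: sumr_ge0 => i _; apply: sumr_ge0 => k _.
    by rewrite mulr_ge0 ?sqr_ge0 // divr_ge0 ?exprn_ge0.
  (* [mass_ratio] turns the unconditioned moment [D] into the conditioned one term by term; it is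
     available because [y] vanishes off the good pairs. *)
  have hD : theta' * mass a n n * D <= 2 * Theta * K * S.
    apply: le_trans (_ : 2 * Theta * K *
      (\sum_(s | ell s == n) wt a s * \sum_i y i (s i) ^+ 2) <= _); last first.
      by rewrite ler_wpM2l // !mulr_ge0 // ltW.
    rewrite (sum_wt_additive a (fun i k => y i k ^+ 2)) /D.
    have mr (i : 'I_n) k : good i k ->
        theta' * mass a n n <= 2 * Theta * K * mass (excl a i.+1) n (n - i.+1 * k).
      move=> /and3P[k0 h4 hi]; apply: mass_ratio => //.
      by apply: le_trans hK0 _; rewrite ler_pM2l // ler_nat.
    move: (theta' * mass a n n) mr => M mr.
    rewrite !mulr_sumr; apply: ler_sum => i _.
    rewrite !mulr_sumr [leRHS]big_mkcond /=; apply: ler_sum => k _.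
    have b0 : 0 <= a i.+1 ^+ k / k`!%:R * y i k ^+ 2.
      by rewrite mulr_ge0 ?sqr_ge0 // divr_ge0 ?exprn_ge0.
    case gd: (good i k); last first.
      by rewrite /y gd expr0n /= !mulr0; case: ifP.
    have /and3P[k0 h4 hi] := gd.
    rewrite ifT; last by apply: leq_trans h4; rewrite leq_pmull.
    apply: le_trans (ler_wpM2r b0 (mr i k gd)) _.
    by rewrite le_eqVlt; apply/orP; left; apply/eqP; ring.
  have hW : theta' * W <= n%:R * mass a n n.
    by apply: le_trans (E_le_mass n0); rewrite ler_pM2l //; exact: E_ge_weights.
  have n1 : 0 < n%:R :> F by rewrite ltr0n.
  rewrite -(ler_pM2l n1); apply: le_trans hc _.
  have t2 : 0 < theta' ^+ 2 by rewrite exprn_gt0.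
  have -> : n%:R * ((3 + 12 * Theta ^+ 2 * K / theta' ^+ 2) * S) =
     3 * n%:R * S + 12 * Theta ^+ 2 * K / theta' ^+ 2 * n%:R * S by ring.
  apply: lerD; first by rewrite ler_wpM2l // mulr_ge0.
  rewrite -(ler_pM2l t2).
  (* The 12 is 6 from [size_biased_variance] times 2 from [hD]. One factor theta' is spent in [hW],
     the other in [hD]. *)
  have -> : theta' ^+ 2 * (12 * Theta ^+ 2 * K / theta' ^+ 2 * n%:R * S) =
    6 * Theta * n%:R * (2 * Theta * K * S) by field; rewrite gt_eqF.
  apply: le_trans (_ : 6 * Theta * n%:R * (theta' * mass a n n * D) <= _); last first.
    by rewrite ler_wpM2l // !mulr_ge0.
  have -> : theta' ^+ 2 * (6 * Theta * W * D) = 6 * Theta * theta' * D * (theta' * W) by ring.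
  have -> : 6 * Theta * n%:R * (theta' * mass a n n * D) =
     6 * Theta * theta' * D * (n%:R * mass a n n) by ring.
  by rewrite ler_wpM2l // !mulr_ge0 // ltW.
apply: le_trans (_ : \sum_(s | ell s == n) (2 * (wt a s * (\sum_i y i (s i) - c) ^+ 2) +
    2 * (K0 + 4)%:R * (wt a s * \sum_i x i (s i) ^+ 2)) <= _).
  apply: ler_sum => s /eqP es.
  under eq_bigr do rewrite xyz.
  rewrite big_split /=; set Y := \sum_i y _ _; set Z := \sum_i z _ _.
  have w0 := wt_ge0 s a_ge0.
  have e1 := sqr_ge0 (Y - c - Z).
  have e2 : (Y + Z - c) ^+ 2 <= 2 * (Y - c) ^+ 2 + 2 * Z ^+ 2.
    have -> : (Y + Z - c) ^+ 2 = 2 * (Y - c) ^+ 2 + 2 * Z ^+ 2 - (Y - c - Z) ^+ 2 by ring.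
    by rewrite lerBlDr lerDl.
  have := zS s es; rewrite -/Z => hz; move: (\sum_i x i _ ^+ 2) hz => X hz.
  have -> : 2 * (wt a s * (Y - c) ^+ 2) + 2 * (K0 + 4)%:R * (wt a s * X) =
    wt a s * (2 * (Y - c) ^+ 2 + 2 * ((K0 + 4)%:R * X)) by ring.
  by rewrite ler_wpM2l // (le_trans e2) // lerD2l ler_pM2l.
rewrite big_split /= -!mulr_sumr -/S [leRHS]mulrDl lerD2r -mulrA ler_pM2l //.
Qed.

End TuranKubilius.

(** * Counting assemblies by their block-size type *)

Section PartitionTypes.
Local Open Scope ring_scope.
Variable n : nat.
Implicit Types (A B : {set 'I_n}) (P : {set {set 'I_n}}).

Definition block_counts P : {ffun 'I_n -> 'I_n.+1} :=
  [ffun i : 'I_n => inord (kcount P i.+1)].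

Lemma block_countsE P A (i : 'I_n) : partition P A ->
  block_counts P i = kcount P i.+1 :> nat.
Proof.
move=> pA; rewrite ffunE inordK // ltnS.
apply: leq_trans (_ : #|P| <= _)%N.
  by apply: subset_leq_card; apply/subsetP => B; rewrite inE => /andP[].
apply: leq_trans (_ : #|A| <= _)%N; last first.
  by rewrite -[leqRHS]card_ord max_card.
rewrite (card_partition pA) -sum1_card; apply: leq_sum => B BP.
by rewrite card_gt0 (partition_neq0 pA).
Qed.

Lemma ell_block_counts P A : partition P A -> ell (block_counts P) = #|A|.
Proof.
move=> pA; rewrite (card_partition pA) /ell.
transitivity (\sum_(i < n) \sum_(B in P | #|B| == i.+1) #|B|)%N.
  apply: eq_bigr => i _; rewrite (block_countsE i pA) /kcount.
  rewrite (eq_bigr (fun=> i.+1)) => [|B /andP[_ /eqP] //].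
  rewrite -sum1_card big_distrr /= (eq_bigl _ _ (in_set _)).
  by apply: eq_bigr => B _; rewrite muln1.
rewrite (exchange_big_dep (mem P)) /=; last by move=> i B _ /andP[].
apply: eq_bigr => B BP; have B0 : (0 < #|B|)%N by rewrite card_gt0 (partition_neq0 pA).
have Bn : (#|B|.-1 < n)%N by rewrite prednK // -[leqRHS]card_ord max_card.
rewrite (big_pred1 (Ordinal Bn)) // => i.
by rewrite BP /= -[in LHS](prednK B0) eqSS eq_sym.
Qed.

Lemma kcount_setU1 P B j : B \notin P ->
  kcount (B |: P) j = ((#|B| == j) + kcount P j)%N.
Proof.
move=> BP; rewrite /kcount -!sum1_card !(eq_bigl _ _ (in_set _)) !big_mkcondr /=.
by rewrite big_setU1 //= sum1_card; case: eqP.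
Qed.

Lemma block_counts_setU1 P A B (i : 'I_n) : partition P A ->
  B \notin P -> #|B| = i.+1 -> block_counts (B |: P) = inc i (block_counts P).
Proof.
move=> pA BP Bi; apply/ffunP => j; rewrite /inc ffunE kcount_setU1 // Bi.
case: (eqVneq j i) => [->|ji]; first by rewrite upd_eq eqxx (block_countsE i pA).
rewrite upd_neq // ffunE eqSS (_ : (nat_of_ord i == j) = false) //.
by apply/negbTE; rewrite eq_sym.
Qed.

(** The left side is the condition that [reindex_onto] yields when a block is added and removed
    again; its second conjunct amounts to [B \notin P]. *)
Lemma partition_setU1E P A B : B \subset A -> B != set0 ->
  partition (B |: P) A && ((B |: P) :\ B == P) = partition P (A :\: B).
Proof.
move=> BA B0; apply/andP/idP => [[pA /eqP e]|pAB].
  by rewrite -[P in partition P _]e partitionD1 // setU11.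
have dis : [disjoint B & A :\: B].
  by rewrite -setI_eq0; apply/eqP/setP => x; rewrite !inE; case: (x \in B).
split; last first.
  apply/eqP/setU1K/negP => /(partitionS pAB).
  by move: dis; rewrite -setI_eq0 => /eqP dis /setIidPl;
    rewrite dis => /esym/eqP; rewrite (negbTE B0).
have := partitionU1 pAB B0 dis.
by rewrite setDE setUIr setUCr setIT (setUidPr BA).
Qed.

Variables (F : realFieldType) (g : nat -> nat).
Let lamF j : F := (g j)%:R / j`!%:R.
Let str P : F := \prod_(B in P) (g #|B|)%:R.

(** Deleting [B] is a bijection onto partitions of [A :\: B]. As [B] is nonempty, [A :\: B] has
    fewer than n points, so [inc] does not overflow. *)
Lemma sum_partitions_block A B (i : 'I_n) (s : {ffun 'I_n -> 'I_n.+1}) :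
  B \subset A -> #|B| = i.+1 -> (0 < s i)%N ->
  \sum_(P | [&& partition P A, block_counts P == s & B \in P]) str P =
  (g i.+1)%:R * \sum_(P | partition P (A :\: B) && (block_counts P == dec i s)) str P.
Proof.
move=> BA Bi si; have B0 : B != set0 by rewrite -card_gt0 Bi.
have AB : (#|A :\: B| < n)%N.
  have := cardsID B A; rewrite (setIidPr BA) Bi => e.
  have : (#|A| <= n)%N by rewrite -[leqRHS]card_ord max_card.
  by rewrite -e addSn; apply: leq_trans; rewrite ltnS leq_addl.
rewrite (reindex_onto (fun P => B |: P) (fun P => P :\ B)) /=; last first.
  by move=> P /and3P[_ _ BP]; rewrite setD1K.
rewrite mulr_sumr; apply: eq_big => [P|P].
  rewrite setU11 andbT andbAC partition_setU1E //.
  case pAB: (partition _ _) => //=.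
  have /andP[_ /eqP e] : partition (B |: P) A && ((B |: P) :\ B == P).
    by rewrite partition_setU1E.
  have BP : B \notin P by rewrite -e !inE eqxx.
  rewrite (block_counts_setU1 pAB BP Bi); apply/eqP/eqP => [<-|->].
    by rewrite incK // (ell_block_counts pAB).
  exact: decK.
move=> /andP[_ /eqP e]; have BP : B \notin P by rewrite -e !inE eqxx.
by rewrite /str big_setU1 //= Bi.
Qed.

(** Induction on a bound for the cardinal of [A]. Choosing a block of a size that occurs gives a
    binomial coefficient times the count for a smaller set, and dividing by [s i] corrects for the
    choice. *)
Lemma sum_partitions A (s : {ffun 'I_n -> 'I_n.+1}) : ell s = #|A| ->
  \sum_(P | partition P A && (block_counts P == s)) str P = #|A|`!%:R * wt lamF s.
Proof.
move: {2}#|A| (leqnn #|A|) => m; elim: m A s => [|m IH] A s.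
  rewrite leqn0 cards_eq0 => /eqP -> /eqP; rewrite cards0 ell0 => /eqP ->.
  have bc0 : block_counts set0 = [ffun=> ord0].
    apply/ffunP => i; apply: val_inj.
    rewrite /= (@block_countsE _ set0) ?partition_set0 // ffunE /=.
    by apply/eqP; rewrite cards_eq0; apply/eqP/setP => B; rewrite !inE.
  rewrite (big_pred1 set0) => [|P]; last first.
    by rewrite partition_set0 /=; case: (eqVneq P set0) => // ->; rewrite bc0 eqxx.
  rewrite /str big_set0 /wt big1 ?mulr1 // => i _.
  by rewrite ffunE expr0 divr1.
move=> Am es; case: (pickP (fun i => 0 < s i)%N) => [i si|s0]; last first.
  apply: IH => //; rewrite -es /ell big1 // => i _.
  by have := s0 i; case: (nat_of_ord (s i)) => //; rewrite muln0.
have s1 : (s i)%:R != 0 :> F by rewrite pnatr_eq0 -lt0n.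
apply: (mulfI s1); rewrite mulrCA wt_dec // mulr_sumr.
transitivity (\sum_(P | partition P A && (block_counts P == s))
   \sum_(B in P | #|B| == i.+1) str P).
  apply: eq_bigr => P /andP[pA /eqP <-].
  rewrite (block_countsE i pA) /kcount sumr_const -[RHS]mulr_natl; congr (_%:R * _).
  by apply: eq_card => B; rewrite !inE.
(* double count pairs (P, B) with B a block of P of size i.+1 *)
rewrite (exchange_big_dep (fun B => (B \subset A) && (#|B| == i.+1))) /=; last first.
  by move=> P B /andP[pA _] /andP[BP ->]; rewrite (partitionS pA).
have iA : (i.+1 <= #|A|)%N by rewrite -es; apply: leq_trans (leq_ell s i); rewrite leq_pmulr.
transitivity (\sum_(B : {set 'I_n} | (B \subset A) && (#|B| == i.+1))
    (g i.+1)%:R * ((#|A| - i.+1)`!%:R * wt lamF (dec i s))).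
  apply: eq_bigr => B /andP[BA /eqP Bi].
  have cAB : #|A :\: B| = (#|A| - i.+1)%N by rewrite cardsD (setIidPr BA) Bi.
  rewrite -cAB -IH; last 2 first.
  - by rewrite cAB leq_subLR addSn (leq_trans Am) // ltnS leq_addl.
  - by rewrite cAB -es -(ell_dec si) addnK.
  rewrite -sum_partitions_block //; apply: eq_bigl => P.
  by rewrite Bi eqxx andbT andbA.
rewrite (eq_bigl (mem [set B : {set 'I_n} | B \subset A & #|B| == i.+1])) => [|B]; last first.
  by rewrite /= inE.
rewrite sumr_const cards_draws -(bin_fact iA) -[LHS]mulr_natl natrM (natrM _ i.+1`!).
have f0 : i.+1`!%:R != 0 :> F by rewrite pnatr_eq0 -lt0n fact_gt0.
have : lamF i.+1 * i.+1`!%:R = (g i.+1)%:R by rewrite divfK.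
by move: (lamF _) (i.+1`!%:R) => l f <-; ring.
Qed.

Lemma sum_partitions_setT (f : {ffun 'I_n -> 'I_n.+1} -> F) :
  \sum_(P | partition P [set: 'I_n]) str P * f (block_counts P) =
  n`!%:R * \sum_(s | ell s == n) wt lamF s * f s.
Proof.
rewrite (partition_big block_counts (fun s => ell s == n)) /=; last first.
  by move=> P /ell_block_counts ->; rewrite cardsT card_ord.
rewrite mulr_sumr; apply: eq_bigr => s /eqP es.
rewrite mulrA -[n in n`!]card_ord -cardsT -sum_partitions ?cardsT ?card_ord //.
by rewrite mulr_suml; apply: eq_bigr => P /andP[_ /eqP ->].
Qed.

End PartitionTypes.

(** * Tilting the weights and centring at the mean *)

Section Scaling.
Local Open Scope ring_scope.
Variable F : realFieldType.

(** The tilt depends on [s] only through [ell s], so conditioning on [ell] makes it a common factor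
    that cancels. *)
Lemma wt_scale (a : nat -> F) (r : F) n (s : {ffun 'I_n -> 'I_n.+1}) :
  wt (fun j => a j * r ^+ j) s = r ^+ ell s * wt a s.
Proof.
rewrite /wt /ell expr_sum -big_split /=; apply: eq_bigr => i _.
by rewrite exprMn -exprM; ring.
Qed.

Lemma sum_wt_scale (a : nat -> F) (r : F) n m (f : {ffun 'I_n -> 'I_n.+1} -> F) :
  \sum_(s | ell s == m) wt (fun j => a j * r ^+ j) s * f s =
  r ^+ m * \sum_(s | ell s == m) wt a s * f s.
Proof.
rewrite mulr_sumr; apply: eq_bigr => s /eqP <-.
by rewrite wt_scale mulrA.
Qed.

Lemma mass_scale (a : nat -> F) (r : F) n m :
  mass (fun j => a j * r ^+ j) n m = r ^+ m * mass a n m.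
Proof. by rewrite mulr_sumr; apply: eq_bigr => s /eqP <-; rewrite wt_scale. Qed.

Lemma variance_le_center (T : finType) (D : pred T) (w f : T -> F) (m c : F) :
  (forall t, 0 <= w t) -> m * (\sum_(t | D t) w t) = \sum_(t | D t) w t * f t ->
  \sum_(t | D t) w t * (f t - m) ^+ 2 <= \sum_(t | D t) w t * (f t - c) ^+ 2.
Proof.
move=> w0 me.
have -> : \sum_(t | D t) w t * (f t - c) ^+ 2 =
    \sum_(t | D t) w t * (f t - m) ^+ 2 +
    2 * (m - c) * (\sum_(t | D t) w t * f t - m * \sum_(t | D t) w t) +
    (m - c) ^+ 2 * \sum_(t | D t) w t.
  by rewrite 2!mulr_sumr -sumrB mulr_sumr -!big_split /=; apply: eq_bigr => t _; ring.
by rewrite me subrr mulr0 addr0 lerDl mulr_ge0 ?sqr_ge0 // sumr_ge0.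
Qed.

End Scaling.

(** * Bounds for the real exponential *)

Section RealExponential.
Local Open Scope ring_scope.

(** A partial sum of a convergent series with nonnegative terms. *)
Lemma sum_le_exp (x : R) m : 0 <= x -> \sum_(k < m.+1) x ^+ k / k`!%:R <= exp x.
Proof.
move=> x0; rewrite /exp; case: exist_exp => l /= hl.
pose An (i : nat) := Rmult (Rinv (INR (Factorial.fact i))) (pow x i).
have -> : \sum_(k < m.+1) x ^+ k / k`!%:R = sum_f_R0 An m.
  rewrite sum_f_R0E big_mkord; apply: eq_bigr => k _.
  by rewrite /An INRE factE RpowE mulrC.
apply/RleP; apply: sum_incr => [|k]; first exact: hl.
by apply/RleP; rewrite /An INRE factE RpowE mulr_ge0 ?exprn_ge0 ?invr_ge0.
Qed.

Lemma prod_exp (I : finType) (f : I -> R) : \prod_i exp (f i) = exp (\sum_i f i).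
Proof.
symmetry; apply: (big_morph exp) => [x y|]; last exact: expR0.
by rewrite -expRD.
Qed.

Lemma ler_exp (x y : R) : x <= y -> exp x <= exp y.
Proof.
rewrite le_eqVlt => /orP[/eqP -> //|/RltP h]; apply/ltW/RltP; exact: exp_increasing.
Qed.

Lemma exp_gt0 (x : R) : 0 < exp x.
Proof. by apply/RltP; exact: exp_pos. Qed.

Variables (a : nat -> R) (Theta : R).
Hypothesis a_ge0 : forall i, 0 <= a i.
Hypothesis a_le : forall i, i.+1%:R * a i.+1 <= Theta.

Lemma prod_sum_le_exp m :
  \prod_(i < m) \sum_(k < m.+1) (a i.+1 ^+ k / k`!%:R) <= exp (\sum_(i < m) a i.+1).
Proof.
rewrite -prod_exp; apply: ler_prod => i _; rewrite sum_le_exp // andbT.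
by apply: sumr_ge0 => k _; rewrite divr_ge0 ?exprn_ge0.
Qed.

Lemma exp_sum_mono m n : (m <= n)%N ->
  exp (\sum_(i < m) a i.+1) <= exp (\sum_(i < n) a i.+1).
Proof.
move=> mn; apply: ler_exp; rewrite -!(big_mkord xpredT (fun i => a i.+1)).
by rewrite [X in _ <= X](big_cat_nat (n := m)) //= lerDl sumr_ge0.
Qed.

(** The n - m <= m extra terms are each at most Theta / m, so the exponent grows by at most
    Theta. *)
Lemma exp_sum_doubling m n : (n <= 2 * m)%N ->
  exp (\sum_(i < n) a i.+1) <= exp Theta * exp (\sum_(i < m) a i.+1).
Proof.
have T0 : 0 <= Theta by apply: le_trans (a_le 0%N); rewrite mulr_ge0.
move=> n2m; have [nm|mn] := leqP n m.
  apply: le_trans (exp_sum_mono nm) _; rewrite ler_peMl ?(ltW (exp_gt0 _)) //.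
  by rewrite -expR0; exact: ler_exp.
have m0 : 0 < m%:R :> R by rewrite ltr0n; case: (m) n2m mn => //; rewrite muln0; case: (n).
rewrite [leRHS]expRD; apply: ler_exp; rewrite -!(big_mkord xpredT (fun i => a i.+1)).
rewrite [X in X <= _](big_cat_nat (n := m)) //= 1?ltnW // addrC lerD2r -(ler_pM2l m0).
apply: le_trans (_ : \sum_(m <= i < n) Theta <= _).
  rewrite mulr_sumr big_nat [leRHS]big_nat; apply: ler_sum => i /andP[mi _].
  by apply: le_trans (a_le i); rewrite ler_wpM2r // ler_nat ltnW.
rewrite sumr_const_nat -[leLHS]mulr_natl ler_wpM2r // ler_nat leq_subLR addnn -mul2n //.
Qed.

End RealExponential.

(** * Transfer to the quantities of the statement *)

Section Transfer.
Local Open Scope ring_scope.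
Variable g : nat -> nat.

Lemma rsumE (I : Type) (r : seq I) (P : pred I) (f : I -> R) :
  \big[Rplus/R0]_(i <- r | P i) f i = \sum_(i <- r | P i) f i.
Proof. by []. Qed.

Lemma lamE j : lam g j = (g j)%:R / j`!%:R :> R.
Proof. by rewrite /lam !INRE RdivE. Qed.

Lemma QtermE n (s : {ffun 'I_n -> 'I_n.+1}) : Qterm g s = wt (lam g) s.
Proof. by apply: eq_bigr => i _; rewrite RpowE INRE RdivE. Qed.

Lemma QE n : Q g n = mass (lam g) n n.
Proof. by apply: eq_bigr => s _; exact: QtermE. Qed.

Lemma QexclE j n : Qexcl g j n = mass (excl (lam g) j) n n.
Proof. by rewrite mass_excl_forall; apply: eq_bigr => s _; exact: QtermE. Qed.

Lemma sum_nstruct n (f : {ffun 'I_n -> 'I_n.+1} -> R) :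
  \sum_(P : {set {set 'I_n}} | setpart P) nstruct g P * f (block_counts P) =
  n`!%:R * \sum_(s | ell s == n) wt (lam g) s * f s.
Proof.
have -> : \sum_(s | ell s == n) wt (lam g) s * f s =
    \sum_(s | ell s == n) wt (fun j => (g j)%:R / j`!%:R) s * f s.
  by apply: eq_bigr => s _; congr (_ * _); apply: eq_bigr => i _; rewrite lamE.
rewrite -sum_partitions_setT; apply: eq_bigr => P _; congr (_ * _).
by apply: eq_bigr => B _; rewrite INRE.
Qed.

Lemma GcountE n : Gcount g n = n`!%:R * Q g n.
Proof.
rewrite QE /mass; under eq_bigr do rewrite -[wt _ _]mulr1.
by rewrite -sum_nstruct; apply: eq_bigr => P _; rewrite mulr1.
Qed.

Lemma hvalE (h : nat -> nat -> R) n (P : {set {set 'I_n}}) : setpart P ->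
  hval h P = \sum_(i < n) h i.+1 (block_counts P i).
Proof.
move=> pP; rewrite /hval rsumE big_mkcond big_ord_recl /= add0r.
by apply: eq_bigr => i _; rewrite (block_countsE i pP).
Qed.

(** The factor n! cancels in mean and variance, and the mean minimises the second moment over all
    centres. *)
Lemma Vn_le n (h : nat -> nat -> R) (c : R) : 0 < Q g n ->
  Vn g (fun P : {set {set 'I_n}} => hval h P) <=
  (\sum_(s : {ffun 'I_n -> 'I_n.+1} | ell s == n)
     wt (lam g) s * (\sum_(i < n) h i.+1 (s i) - c) ^+ 2) / Q g n.
Proof.
move=> Q0; pose phi (s : {ffun 'I_n -> 'I_n.+1}) := \sum_(i < n) h i.+1 (s i).
have f0 : n`!%:R != 0 :> R by rewrite pnatr_eq0 -lt0n fact_gt0.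
have lam_ge0 j : 0 <= lam g j by rewrite lamE divr_ge0.
have En_phi : En g (fun P : {set {set 'I_n}} => hval h P) =
    (\sum_(s | ell s == n) wt (lam g) s * phi s) / Q g n.
  rewrite /En GcountE RdivE.
  rewrite (_ : \big[_/_]_(P | _) _ = n`!%:R * \sum_(s | ell s == n) wt (lam g) s * phi s).
    by rewrite invfM mulrACA divff // mul1r.
  by rewrite -sum_nstruct; apply: eq_bigr => P pP; rewrite hvalE.
rewrite /Vn En_phi; set m := _ / _.
rewrite GcountE RdivE.
rewrite (_ : \big[_/_]_(P | _) _ =
    n`!%:R * \sum_(s | ell s == n) wt (lam g) s * (phi s - m) ^+ 2); last first.
  by rewrite -sum_nstruct; apply: eq_bigr => P pP; rewrite hvalE.
rewrite invfM mulrACA divff // mul1r ler_pM2r ?invr_gt0 // /m QE.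
by apply: variance_le_center => [s|]; [exact: wt_ge0 | rewrite -/(mass _ _ _) divfK // -QE gt_eqF].
Qed.

Lemma variance_bound_sum n (h : nat -> nat -> R) :
  (forall j, (j <= n)%N -> h j 0%N = 0) ->
  \big[Rplus/R0]_(j < n.+1) \big[Rplus/R0]_(k < n.+1 | (0 < j)%N && (0 < k)%N && (j * k <= n)%N)
     (Rmult (Rdiv (Rmult (pow (lam g j) k) (Rsqr (h j k))) (INR k`!))
       (Rdiv (Qexcl g j (n - j * k)) (Q g n))) =
  (\sum_(s : {ffun 'I_n -> 'I_n.+1} | ell s == n)
     wt (lam g) s * \sum_(i < n) h i.+1 (s i) ^+ 2) / Q g n :> R.
Proof.
move=> h0; rewrite (sum_wt_additive (lam g) (fun (i : 'I_n) k => h i.+1 k ^+ 2)).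
rewrite rsumE big_ord_recl big_pred0 // [LHS]add0r mulr_suml; apply: eq_bigr => i _.
rewrite rsumE mulr_suml big_mkcond [RHS]big_mkcond /=; apply: eq_bigr => k _.
rewrite /bump /= add1n.
(* [sum_wt_additive] also has terms with [k = 0]; they vanish because [h j 0 = 0]. *)
case: (posnP k) => [->|k0] /=; first by rewrite h0 ?ltn_ord // expr0n mulr0 mul0r if_same.
case: ifP => // ik.
rewrite QexclE RpowE INRE !RdivE /Rsqr !RmultE.
rewrite (@mass_dim _ _ _ n (n - i.+1 * k)) ?leq_subr //; ring.
Qed.

(** Apply [turan_kubilius_vectors] to a_j = lambda_j rho^j with [K = exp Theta]; the powers rho^n on
    both sides cancel. *)
Lemma variance_le rho Theta theta' (K0 : nat) n (h : nat -> nat -> R) :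
  0 < rho -> 0 < theta' ->
  (forall j, (1 <= j)%N -> rho ^+ j * j%:R * lam g j <= Theta) ->
  (forall m, (1 <= m)%N ->
     theta' * exp (\sum_(i < m) lam g i.+1 * rho ^+ i.+1) <= m%:R * Q g m * rho ^+ m) ->
  4 * Theta ^+ 2 * exp Theta <= theta' * K0%:R ->
  (1 <= n)%N -> (forall j, (j <= n)%N -> h j 0%N = 0) ->
  Vn g (fun P : {set {set 'I_n}} => hval h P) <=
  (2 * (3 + 12 * Theta ^+ 2 * exp Theta / theta' ^+ 2) + 2 * (K0 + 4)%:R) *
  ((\sum_(s : {ffun 'I_n -> 'I_n.+1} | ell s == n)
     wt (lam g) s * \sum_(i < n) h i.+1 (s i) ^+ 2) / Q g n).
Proof.
move=> rho0 t0 lam_le Q_ge hK0 n1 h0.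
pose a j := lam g j * rho ^+ j.
have a_ge0 j : 0 <= a j by rewrite /a lamE mulr_ge0 ?divr_ge0 // exprn_ge0 ?ltW.
have a_le i : i.+1%:R * a i.+1 <= Theta.
  by apply: le_trans (lam_le i.+1 isT); rewrite /a le_eqVlt; apply/orP; left; apply/eqP; ring.
have low m : (0 < m)%N -> theta' * exp (\sum_(i < m) a i.+1) <= m%:R * mass a m m.
  by move=> m0; apply: le_trans (Q_ge m m0) _; rewrite mass_scale QE -mulrA [_ * mass _ _ _]mulrC.
have Q0 : 0 < Q g n.
  have := lt_le_trans _ (Q_ge n n1).
  move=> /(_ 0); rewrite mulr_gt0 ?exp_gt0 // => /(_ isT).
  by rewrite pmulr_lgt0 ?exprn_gt0 // pmulr_rgt0 // ltr0n.
have [c] := turan_kubilius_vectors a_ge0 a_le t0 (exp_gt0 Theta)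
  (prod_sum_le_exp a_ge0) (exp_sum_mono a_ge0) (exp_sum_doubling a_ge0 a_le) low n1
  (x := fun i k => h i.+1 k) (fun i => h0 i.+1 (ltn_ord i)) hK0.
rewrite !sum_wt_scale mulrCA ler_pM2l ?exprn_gt0 // => hc.
by apply: le_trans (Vn_le h c Q0) _; rewrite mulrA ler_pM2r ?invr_gt0.
Qed.

End Transfer.


(** * Choice of the constant *)

Local Open Scope R_scope.

Theorem theorem1 :
  forall (rho Theta theta theta' : R) (n0 : nat),
    0 < rho -> 0 < Theta -> 0 < theta -> 0 < theta' -> (1 <= n0)%nat ->
    exists C : R, 0 < C /\
      forall g : nat -> nat,
        weakly_logarithmic g rho Theta theta theta' n0 ->
        forall (n : nat) (h : nat -> nat -> R),
          (1 <= n)%nat ->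
          (forall j : nat, (j <= n)%nat -> h j 0%nat = 0) ->
          Vn g (fun P : {set {set 'I_n}} => hval h P) <=
            C * \rsum_(j < n.+1)
                  \rsum_(k < n.+1 | (0 < j)%nat && (0 < k)%nat && (j * k <= n)%nat)
                    (pow (lam g j) k * Rsqr (h j k) / INR (factorial k)
                       * (Qexcl g j (n - j * k) / Q g n)).
Proof.
move=> rho Theta theta theta' n0 rho0 Theta0 theta0 theta'0 n01.
have T0 : (0 <= Theta)%R by apply/ltW/RltP.
have t0 : (0 < theta')%R by apply/RltP.
(* The threshold on j that [mass_ratio] needs for K = exp(Theta); [K0] is an integer above it. *)
pose x : R := (4 * Theta ^+ 2 * exp Theta / theta')%R.
have x0 : (0 <= x)%R.
  by rewrite !mulr_ge0 ?invr_ge0 ?exprn_ge0 // ltW // exp_gt0.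
pose K0 := Num.bound x.
have hK0 : (4 * Theta ^+ 2 * exp Theta <= theta' * K0%:R)%R.
  rewrite [leRHS]mulrC -ler_pdivrMr //; apply: ltW; apply: archi_boundP x0.
exists (2 * (3 + 12 * Theta ^+ 2 * exp Theta / theta' ^+ 2) + 2 * (K0 + 4)%:R)%R; split.
  apply/RltP; rewrite addr_gt0 // mulr_gt0 // ?ltr0n ?addn4 //.
  by rewrite ltr_pwDl // !mulr_ge0 ?invr_ge0 ?exprn_ge0 // ltW // exp_gt0.
move=> g [_ [lam_le [_ Q_ge]]] n h n1 h0; apply/RleP.
have r0 : (0 < rho)%R by apply/RltP.
rewrite variance_bound_sum //; apply: (variance_le r0) => // [j j1|m m1].
  by have /RleP := lam_le j j1; rewrite !RmultE RpowE INRE.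
have /Rge_le/RleP := Q_ge m m1; rewrite RpowE INRE.
rewrite rsumE big_mkcond big_ord_recl /= add0r => h1.
apply: le_trans h1; rewrite RmultE ler_pM2l //; apply: ler_exp.
by apply: ler_sum => i _; rewrite -RpowE.
Qed.
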